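(* Let $k \geqslant 2$ and let $p = (p_1, \ldots, p_k)$ and $q = (q_1, \ldots, q_k)$ be two arrays of positive integers of length $k$ such that $p \prec q$. Then $T(p) \preceq_c T(q)$; that is, with $n = 1 + p_1 + \cdots + p_k = 1 + q_1 + \cdots + q_k$, one has $c_j(T(p)) \leqslant c_j(T(q))$ for all $j = 0, 1, \ldots, n$.
   Context: For a simple graph $G$ on $n$ vertices with Laplacian matrix $L(G) = D(G) - A(G)$ (degree matrix minus adjacency matrix), the Laplacian coefficients $c_0(G), \ldots, c_n(G)$ are defined by $\det(\lambda I_n - L(G)) = \sum_{j=0}^n (-1)^j c_j(G) \lambda^{n-j}$. For $n$-vertex graphs $G, H$, write $G \preceq_c H$ if $c_j(G) \leqslant c_j(H)$ for all $j = 0, 1, \ldots, n$. The starlike tree $T(n_1, \ldots, n_k)$ is the tree composed of a root vertex $v$ and $k$ paths of lengths $n_1, \ldots, n_k$ attached at $v$ (so each $n_i$ counts the vertices of the $i$-th path other than $v$); it has $n_1 + \cdots + n_k + 1$ vertices. Majorization: for integer arrays $x = (x_1, \ldots, x_k)$ and $y = (y_1, \ldots, y_k)$, write $x \prec y$ if (i) $x_1 \geqslant x_2 \geqslant \cdots \geqslant x_k$ and $y_1 \geqslant y_2 \geqslant \cdots \geqslant y_k$; (ii) $x_1 + \cdots + x_m \leqslant y_1 + \cdots + y_m$ for every $1 \leqslant m < k$; (iii) $x_1 + \cdots + x_k = y_1 + \cdots + y_k$. *)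

(* Defs.v *)
From HB Require Import structures.
From mathcomp Require Import all_boot all_order all_algebra.

Set Implicit Arguments.
Unset Strict Implicit.
Unset Printing Implicit Defensive.

Import Order.TTheory GRing.Theory Num.Theory.
Local Open Scope ring_scope.

Record sgraph := SGraph {
  vertex :> finType;
  adj : rel vertex;
  adj_sym : symmetric adj;
  adj_irrefl : irreflexive adj }.

Definition degree (G : sgraph) (u : G) : nat := #|[set v : G | adj u v]|.

(* Matrices are indexed by 'I_#|G| through the enumeration of the vertices;
   a different enumeration only conjugates them by a permutation matrix. *)
Definition adjacency_mx (G : sgraph) : 'M[int]_#|G| :=
  \matrix_(i, j) (adj (enum_val i) (enum_val j))%:R.

Definition degree_mx (G : sgraph) : 'M[int]_#|G| :=
  diag_mx (\row_i (degree (enum_val i))%:R).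

Definition laplacian (G : sgraph) : 'M[int]_#|G| :=
  degree_mx G - adjacency_mx G.

(* Only meaningful for j <= #|G|, because of the truncated subtraction. *)
Definition lap_coef (G : sgraph) (j : nat) : int :=
  (-1) ^+ j * (char_poly (laplacian G))`_(#|G| - j).

Lemma lap_coefE (G : sgraph) :
  \det ('X%:M - map_mx polyC (laplacian G)) =
  \sum_(j < #|G|.+1) ((-1) ^+ j * lap_coef G j) *: 'X^(#|G| - j).
Proof.
rewrite -[LHS]/(char_poly (laplacian G)) -[LHS]coefK size_char_poly poly_def.
rewrite (reindex_inj rev_ord_inj) /=.
apply: eq_bigr => j _; rewrite subSS /lap_coef mulrA -exprD addnn -mul2n.
by rewrite exprM sqrrN !expr1n mul1r.
Qed.

Definition lap_coef_le (G H : sgraph) : Prop :=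
  #|G| = #|H| /\
  forall j : nat, (j <= #|G|)%N -> lap_coef G j <= lap_coef H j.

Section Starlike.
Variables (k : nat) (p : 'I_k -> nat).

(* None is the root; Some (i, j) is the vertex of the i-th path at distance
   j + 1 from the root. *)
Definition starlike_vertex : finType := option {i : 'I_k & 'I_(p i)}.

(* v is the child of u when the tree is rooted at None. *)
Definition starlike_child (u v : starlike_vertex) : bool :=
  match u, v with
  | None, Some y => tagged y == 0%N :> nat
  | Some x, Some y => (tag x == tag y) && ((tagged x).+1 == tagged y :> nat)
  | _, None => false
  end.

Definition starlike_adj : rel starlike_vertex :=
  [rel u v | starlike_child u v || starlike_child v u].

Lemma starlike_adj_sym : symmetric starlike_adj.
Proof. by move=> u v; exact: orbC. Qed.

Lemma starlike_adj_irrefl : irreflexive starlike_adj.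
Proof. by case=> [x|]; rewrite /starlike_adj /= ?orbb ?eqxx ?eqn_leq ?ltnn //=. Qed.

Definition starlike : sgraph := SGraph starlike_adj_sym starlike_adj_irrefl.

Lemma card_starlike : #|starlike| = (1 + \sum_(i < k) p i)%N.
Proof.
rewrite card_option card_tagged sumnE big_map big_enum /= add1n.
by congr _.+1; apply: eq_bigr => i _; rewrite card_ord.
Qed.

End Starlike.

Definition majorized (k : nat) (x y : 'I_k -> int) : Prop :=
  [/\ (forall i j : 'I_k, (i <= j)%N -> x j <= x i) /\
      (forall i j : 'I_k, (i <= j)%N -> y j <= y i),
      (forall m : nat, (1 <= m < k)%N ->
        \sum_(i < k | (i < m)%N) x i <= \sum_(i < k | (i < m)%N) y i)
    & \sum_(i < k) x i = \sum_(i < k) y i].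

(* Main.v *)
Require Import Defs.
From mathcomp Require Import all_boot all_order all_algebra.
From mathcomp Require Import fingroup perm ring zify.
Set Implicit Arguments.
Unset Strict Implicit.
Unset Printing Implicit Defensive.
Import Order.TTheory GRing.Theory Num.Theory.
Local Open Scope ring_scope.

(** Substituting -X for X turns the alternating signs of the Laplacian
    coefficients into none: c_j is the coefficient of X^(n-j) in
    det(X + L).  So the claim is that det(X + L(T(q))) - det(X + L(T(p)))
    has nonnegative coefficients.

    This determinant is computed by the elimination of a rooted tree from its
    leaves ([det_rooted_tree]).  Let b_m be the determinant of X + L restricted
    to the m vertices of an arm ([arm_poly]) and write
    b_m - b_(m-1) = X s_m ([arm_incr]); both satisfy recurrences which make
    their coefficients visibly nonnegative.  The result
    ([char_poly_starlike]) is
      det(X + L(T(p))) = X (prod_i b_(p_i) + sum_i s_(p_i) prod_(j <> i) b_(p_j)).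

    Majorization of integer vectors is generated by unit transfers from a
    smaller entry to a larger one ([majorization_ind]), so it remains to
    compare arms of lengths a >= c with arms of lengths a + 1 and c - 1, the
    other arms being fixed.  The formula splits as a term for the path formed
    by the two arms and the root, which only depends on a + c ([arm_path]),
    plus the product b_a b_c times a factor with nonnegative coefficients that
    comes from the other arms.  Finally b_(a+1) b_(c-1) - b_a b_c is X s_(a-c+1)
    by a Wronskian identity ([arm_wronskian]). *)

(** * Polynomials with nonnegative coefficients *)

Definition nneg_coef (p : {poly int}) : Prop := forall i, 0 <= p`_i.

Lemma nneg_coef0 : nneg_coef 0.
Proof. by move=> i; rewrite coef0. Qed.

Lemma nneg_coef1 : nneg_coef 1.
Proof. by move=> i; rewrite coef1; case: (i == 0)%N. Qed.

Lemma nneg_coefX : nneg_coef 'X.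
Proof. by move=> i; rewrite coefX; case: (i == 1)%N. Qed.

Lemma nneg_coefD p q : nneg_coef p -> nneg_coef q -> nneg_coef (p + q).
Proof. by move=> p0 q0 i; rewrite coefD addr_ge0. Qed.

Lemma nneg_coefM p q : nneg_coef p -> nneg_coef q -> nneg_coef (p * q).
Proof. by move=> p0 q0 i; rewrite coefM sumr_ge0 // => j _; apply: mulr_ge0. Qed.

(** * The polynomials of an arm *)

(** The two sequences are generated together so that only additions and a
    multiplication by X occur, which keeps their coefficients nonnegative; the
    usual three-term recurrence b_(m+2) = (X + 2) b_(m+1) - b_m does not show
    it. *)
Fixpoint arm_pair (m : nat) : {poly int} * {poly int} :=
  if m is m'.+1 then
    let: (b, s) := arm_pair m' in (b + 'X * (s + b), s + b)
  else (1, 0).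

(** The determinant of X + L on the m vertices of an arm, L being the Laplacian
    of the whole tree: a path grounded at the root. *)
Definition arm_poly m := (arm_pair m).1.
(** The path on m - 1 vertices grounded at both ends, that is, the increment
    of [arm_poly] divided by X. *)
Definition arm_incr m := (arm_pair m).2.

Lemma arm_poly0 : arm_poly 0 = 1. Proof. by []. Qed.
Lemma arm_incr0 : arm_incr 0 = 0. Proof. by []. Qed.

Lemma arm_incrS m : arm_incr m.+1 = arm_incr m + arm_poly m.
Proof. by rewrite /arm_incr /arm_poly /=; case: (arm_pair m). Qed.

Lemma arm_polyS m : arm_poly m.+1 = arm_poly m + 'X * arm_incr m.+1.
Proof. by rewrite arm_incrS /arm_incr /arm_poly /=; case: (arm_pair m). Qed.

Lemma arm_nneg m : nneg_coef (arm_poly m) /\ nneg_coef (arm_incr m).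
Proof.
elim: m => [|m [IHb IHs]]; first by split; [exact: nneg_coef1 | exact: nneg_coef0].
have Hs : nneg_coef (arm_incr m.+1) by rewrite arm_incrS; apply: nneg_coefD.
split=> //; rewrite arm_polyS; apply: nneg_coefD => //.
exact: nneg_coefM nneg_coefX Hs.
Qed.

Lemma arm_poly_neq0 m : arm_poly m != 0.
Proof.
suff: (arm_poly m).[0] = 1.
  by move=> b1; apply/eqP => b0; move: b1; rewrite b0 horner0.
by elim: m => [|m IHm]; rewrite ?arm_poly0 ?arm_polyS !hornerE ?IHm ?mul0r ?addr0.
Qed.

(** Both sides, multiplied by X, are det(X + L) for a path on a + c + 2
    vertices, with the root at two consecutive positions. *)
Lemma arm_path a c :
  arm_poly a.+1 * arm_poly c + arm_incr a.+1 * arm_poly c + arm_incr c * arm_poly a.+1 =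
  arm_poly a * arm_poly c.+1 + arm_incr a * arm_poly c.+1 + arm_incr c.+1 * arm_poly a.
Proof. rewrite !arm_polyS !arm_incrS; ring. Qed.

(** The sequences are solutions of one second-order recurrence whose transfer
    matrix has determinant 1, so the left-hand side does not change when both
    indices are shifted together; its value is read off at c = 0. *)
Lemma arm_wronskian c d :
  arm_incr (c + d).+1 * arm_poly c - arm_poly (c + d) * arm_incr c.+1 = arm_incr d.
Proof.
elim: c => [|c IHc]; first by rewrite arm_poly0 !arm_incrS arm_incr0 arm_poly0; ring.
by rewrite -[RHS]IHc addSn !(arm_incrS (_.+1)) !arm_polyS; ring.
Qed.

(** * Unit transfers between two arms *)

(** A closed formula for det(X + L(T(p))), see [char_poly_starlike]. *)
Definition starlike_poly k (p : 'I_k -> nat) : {poly int} :=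
  'X * (\prod_i arm_poly (p i) +
        \sum_i arm_incr (p i) * \prod_(j | j != i) arm_poly (p j)).

Definition transfer k (p : 'I_k -> nat) (a c i : 'I_k) : nat :=
  (p i + (i == a) - (i == c))%N.

Lemma eq_starlike_poly k (p q : 'I_k -> nat) :
  p =1 q -> starlike_poly p = starlike_poly q.
Proof.
move=> epq; rewrite /starlike_poly; congr (_ * (_ + _)).
  by apply: eq_bigr => i _; rewrite epq.
by apply: eq_bigr => i _; rewrite epq; congr (_ * _); apply: eq_bigr => j _; rewrite epq.
Qed.

(** Isolates the two arms that a transfer changes: the first term carries the
    path they form through the root, the second one the remaining arms. *)
Lemma starlike_poly_two k (p : 'I_k -> nat) (a c : 'I_k) : a != c ->
  starlike_poly p =
  'X * ((arm_poly (p a) * arm_poly (p c) + arm_incr (p a) * arm_poly (p c)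
         + arm_incr (p c) * arm_poly (p a)) * \prod_(j | (j != a) && (j != c)) arm_poly (p j)
     + arm_poly (p a) * arm_poly (p c) *
       \sum_(i | (i != a) && (i != c)) arm_incr (p i) *
         \prod_(j | (j != a) && (j != c) && (j != i)) arm_poly (p j)).
Proof.
move=> nac; rewrite /starlike_poly; congr (_ * _).
rewrite (bigD1 a) //= (bigD1 c) 1?eq_sym //=.
rewrite [\sum_i _](bigD1 a) //= [\sum_(i | i != a) _](bigD1 c) 1?eq_sym //=.
rewrite [\prod_(j | j != a) _](bigD1 c) 1?eq_sym //= [\prod_(j | j != c) _](bigD1 a) //=.
rewrite [\prod_(i | (i != c) && _) _](eq_bigl (fun j => (j != a) && (j != c))); last first.
  by move=> j; rewrite andbC.
set P := \prod_(j | (j != a) && _) _.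
set S := \sum_(i | _) _; set S' := \sum_(i | _) _.
have -> : S = arm_poly (p a) * arm_poly (p c) * S'.
  rewrite /S /S' mulr_sumr; apply: eq_bigr => i /andP[ia ic].
  rewrite (bigD1 a) 1?eq_sym //= (bigD1 c) /=; last by rewrite eq_sym ic eq_sym.
  rewrite mulrCA !mulrA; congr (_ * _); first by ring.
  by apply: eq_bigl => j; case: (j == a) (j == c) (j == i) => [] [] [].
by ring.
Qed.

(** The path term is the same before and after the transfer, and the rest
    changes by X^2 s_d times the contribution of the remaining arms, where
    d - 1 is the difference of the two lengths. *)
Lemma starlike_poly_transfer k (p : 'I_k -> nat) (a c : 'I_k) :
  a != c -> (p c <= p a)%N -> (0 < p c)%N ->
  nneg_coef (starlike_poly (transfer p a c) - starlike_poly p).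
Proof.
move=> nac pca pc0; rewrite !(starlike_poly_two _ nac).
have ta : transfer p a c a = (p a).+1 by rewrite /transfer eqxx (negbTE nac) addn1 subn0.
have tc : transfer p a c c = (p c).-1 by rewrite /transfer eqxx eq_sym (negbTE nac) addn0 subn1.
have tj j : (j != a) && (j != c) -> transfer p a c j = p j.
  by case/andP=> ja jc; rewrite /transfer (negbTE ja) (negbTE jc) addn0 subn0.
rewrite ta tc.
rewrite [\prod_(j | _) arm_poly (transfer p a c j)](eq_bigr (fun j => arm_poly (p j))); last first.
  by move=> j /tj ->.
rewrite [\sum_(i | _) arm_incr (transfer p a c i) * _](eq_bigr (fun i => arm_incr (p i) *
   \prod_(j | (j != a) && (j != c) && (j != i)) arm_poly (p j))); last first.
  move=> i /tj ->; congr (_ * _); apply: eq_bigr => j /andP[/tj -> //].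
case: (p c) (p a) pc0 pca => // c' a' _ ca /=.
rewrite arm_path.
set P := \prod_(j | _) _; set S := \sum_(i | _) _.
have -> : a' = (c' + (a' - c'))%N by lia.
move: (a' - c')%N => d.
have -> : forall Z, 'X * (Z * P + arm_poly (c' + d).+1 * arm_poly c' * S) -
   'X * (Z * P + arm_poly (c' + d) * arm_poly c'.+1 * S) = 'X * ('X * arm_incr d * S).
  by move=> Z; rewrite -(arm_wronskian c' d) !arm_polyS; ring.
have Hb m := proj1 (arm_nneg m); have Hs m := proj2 (arm_nneg m).
apply: nneg_coefM; first exact: nneg_coefX.
apply: nneg_coefM; first exact: nneg_coefM nneg_coefX (Hs d).
apply: big_ind => [||i _]; [exact: nneg_coef0 | exact: nneg_coefD |].
apply: nneg_coefM => //.
by apply: big_ind => //; [exact: nneg_coef1 | exact: nneg_coefM].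
Qed.

(** * Majorization by unit transfers *)

Definition psum k (p : 'I_k -> nat) m := (\sum_(i < k | (i < m)%N) p i)%N.

Lemma psumS k (p : 'I_k -> nat) (i : 'I_k) : psum p i.+1 = (psum p i + p i)%N.
Proof.
rewrite /psum (bigD1 i) ?ltnS //= addnC; congr (_ + _)%N.
by apply: eq_bigl => j; rewrite ltnS ltn_neqAle andbC.
Qed.

Lemma psum_delta k (a : 'I_k) m : psum (fun i => (i == a) : nat) m = (a < m)%N.
Proof.
rewrite /psum; case: ltnP => am; last first.
  by apply: big1 => i im; rewrite -val_eqE /=; case: eqP => // ia; lia.
by rewrite (bigD1 a) //= eqxx big1 // => i /andP[_ /negbTE ->].
Qed.

Lemma psum_transfer k (p : 'I_k -> nat) (a c : 'I_k) m : (0 < p c)%N ->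
  (psum (transfer p a c) m + (c < m) = psum p m + (a < m))%N.
Proof.
move=> pc; rewrite -!psum_delta /psum -!big_split /=; apply: eq_bigr => i _.
by rewrite /transfer; case: (i =P c) => [->|_]; lia.
Qed.

Definition nonincreasing k (p : 'I_k -> nat) :=
  forall i j : 'I_k, (i <= j)%N -> (p j <= p i)%N.

(** Muirhead's lemma.  If p differs from q, let a be the first index where they
    differ, so that p a < q a, and c the first index after a where the partial
    sums through that index agree again, so that p c > q c.  Strictly between,
    the partial sums of p have room for the extra unit; and as a starts and c
    ends a run of equal entries of p, the transferred vector is nonincreasing.
    The sum of the excesses of q over p decreases by one. *)
Lemma majorization_ind k (le : ('I_k -> nat) -> ('I_k -> nat) -> Prop) :
  (forall p q, p =1 q -> le p q) ->
  (forall p q (a c : 'I_k), a != c -> (p c <= p a)%N -> (0 < p c)%N ->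
     le (transfer p a c) q -> le p q) ->
  forall p q, nonincreasing p -> nonincreasing q ->
  (forall m, (psum p m <= psum q m)%N) -> psum p k = psum q k -> le p q.
Proof.
move=> le_refl le_step p q sp sq.
have [n] := ubnP (\sum_i (q i - p i))%N.
elim: n p sp => // n IHn p sp mn pq pqk.
have [/forallP e|] := boolP [forall i, p i == q i].
  by apply: le_refl => i; apply/eqP.
rewrite negb_forall => /existsP[i0 i0P].
case: (@arg_minnP _ i0 (fun i => p i != q i) (@nat_of_ord k) i0P) => a aP amin.
have eqlt (i : 'I_k) : (i < a)%N -> p i = q i.
  by move=> ia; apply/eqP; apply: contraLR ia => /amin; rewrite -leqNgt.
have Pa : psum p a = psum q a by apply: eq_bigr => i /eqlt.
have pa : (p a < q a)%N.
  by have := pq a.+1; rewrite !psumS Pa; move/eqP: aP; lia.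
(* The last index is such an r: it is not a, since the total sums agree while
   the partial sums through a do not. *)
have [r rP] : exists r : 'I_k, (a < r)%N && (psum p r.+1 == psum q r.+1).
  have k0 : (k.-1 < k)%N by rewrite ltn_predL (leq_ltn_trans _ (ltn_ord a)).
  exists (Ordinal k0); rewrite /= (ltn_predK k0) pqk eqxx andbT.
  rewrite ltn_neqAle -ltnS (ltn_predK k0) ltn_ord andbT; apply/eqP => ak.
  have aS : a.+1 = k by rewrite ak (ltn_predK k0).
  by have := psumS p a; have := psumS q a; rewrite aS Pa pqk; lia.
case: (@arg_minnP _ r (fun i => (a < i)%N && (psum p i.+1 == psum q i.+1))
  (@nat_of_ord k) rP) => c /andP[ac /eqP Pc] cmin.
have lt_ac m : (a < m <= c)%N -> (psum p m < psum q m)%N.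
  case: m => // m /andP[am mc].
  have mk : (m < k)%N by apply: ltn_trans (ltn_ord c).
  have [e|ne] := eqVneq m a; first by rewrite e !psumS Pa ltn_add2l.
  rewrite ltn_neqAle pq andbT; apply/eqP => Pm.
  by have := cmin (Ordinal mk); rewrite /= Pm eqxx andbT; lia.
have pc : (q c < p c)%N by have := lt_ac c; rewrite ac leqnn => /(_ isT); move: Pc; rewrite !psumS; lia.
have nac : a != c by rewrite -val_eqE /=; lia.
have pc0 : (0 < p c)%N by lia.
apply: (le_step _ _ a c) => //; first exact: sp (ltnW ac).
apply: IHn.
- move=> i j ij; have := sp _ _ ij; rewrite /transfer.
  (* A gap just before a, because p and q agree there and q a > p a, and a gap
     just after c, because p c > q c >= q (c + 1) >= p (c + 1). *)
  have ja : j == a -> i != a -> (p j < p i)%N.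
    move=> /eqP ? ia; subst j.
    have ia' : (i < a)%N by rewrite ltn_neqAle ij andbT.
    by rewrite (eqlt i ia'); apply: leq_trans pa _; apply: sq.
  have ic : i == c -> j != c -> (p j < p i)%N.
    move=> /eqP ? jc; subst i.
    have cj : (c < j)%N by rewrite ltn_neqAle ij andbT eq_sym.
    have ck : (c.+1 < k)%N by apply: leq_ltn_trans (ltn_ord j).
    have := sp (Ordinal ck) j cj; have := sq c (Ordinal ck) (leqnSn _).
    have := pq c.+2; rewrite (psumS p (Ordinal ck)) (psumS q (Ordinal ck)) /= Pc.
    lia.
  have aic : i == c -> j != a.
    by move=> /eqP ?; subst i; apply/eqP => ?; subst j; lia.
  by move: ja ic aic; case: (i == a) (j == a) (i == c) (j == c) => [] [] [] [] /=; lia.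
- have sa : (q a - transfer p a c a < q a - p a)%N by rewrite /transfer eqxx (negbTE nac); lia.
  rewrite -ltnS; apply: leq_trans mn.
  rewrite ltnS (bigD1 a) //= [X in (_ < X)%N](bigD1 a) //= -addSn leq_add //.
  apply: leq_sum => i ia; rewrite /transfer (negbTE ia); case: (i =P c) => [->|]; lia.
- move=> m; have := psum_transfer a m pc0; have := pq m; have := lt_ac m; lia.
- have := psum_transfer a k pc0; rewrite !ltn_ord pqk; lia.
Qed.

(** * Determinants of triangular and shifted Laplacian matrices *)

(** The matrix is triangular once the indices are sorted by rank, but no
    sorting is needed: a permutation with a nonzero term in the Leibniz formula
    never decreases the rank and preserves the sum of all ranks, hence fixes
    every index. *)
Lemma det_ranked (R : comNzRingType) n (A : 'M[R]_n) (r : 'I_n -> nat) :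
  (forall i j, A i j != 0 -> i != j -> (r i < r j)%N) ->
  \det A = \prod_i A i i.
Proof.
move=> rA; rewrite /determinant (bigD1 (1%g : 'S_n)) //= odd_perm1 expr0 mul1r.
rewrite [X in _ + X]big1 ?addr0 => [|s s1].
  by apply: eq_bigr => i _; rewrite perm1.
have [/forallP As|/forallPn[i /negPn/eqP As0]] := boolP [forall i, A i (s i) != 0]; last first.
  by rewrite (bigD1 i) //= As0 mul0r mulr0.
have le_r i : (r i <= r (s i))%N.
  by have [<-//|si] := eqVneq i (s i); apply/ltnW/rA.
have sum_r : (\sum_i r (s i) = \sum_i r i)%N by rewrite [RHS](reindex_perm s).
case/eqP: s1; apply/permP => i; rewrite perm1; apply/eqP/negPn/negP => si.
have: (\sum_i r i < \sum_i r (s i))%N.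
  rewrite (bigD1 i) // [X in (_ < X)%N](bigD1 i) //= -addSn leq_add //.
    by apply: rA => //; rewrite eq_sym.
  exact: leq_sum.
by rewrite sum_r ltnn.
Qed.

Lemma char_poly_oppmx_coef (R : comNzRingType) n (A : 'M[R]_n) i : (i <= n)%N ->
  (char_poly (- A))`_i = (-1) ^+ (n - i) * (char_poly A)`_i.
Proof.
move=> ni.
have -> : char_poly (- A) = (-1) ^+ n *: (char_poly A \Po (- 'X)).
  rewrite /char_poly; have -> : char_poly_mx (- A) =
      (-1) *: map_mx (comp_poly (- 'X)) (char_poly_mx A).
    apply/matrixP => a b; rewrite !mxE comp_polyB rmorphN /= opprK comp_polyC.
    by case: (a == b); rewrite ?mulr1n ?mulr0n ?comp_polyX ?comp_poly0; ring.
  by rewrite detZ det_map_mx -mul_polyC rmorphXn rmorphN1.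
have -> : - 'X = (-1) *: 'X :> {poly R} by rewrite scaleN1r.
rewrite coefZ.
have -> : (char_poly A \Po (-1 *: 'X))`_i = (-1) ^+ i * (char_poly A)`_i.
  rewrite coef_comp_poly; under eq_bigr => j _ do rewrite exprZn coefZ coefXn.
  have [im|mi] := ltnP i (size (char_poly A)).
    rewrite (bigD1 (Ordinal im)) //= eqxx mulr1 big1 ?addr0 1?mulrC // => j.
    by rewrite -val_eqE eq_sym /= => /negbTE ->; rewrite !mulr0.
  rewrite [in RHS]nth_default // mulr0 big1 // => j _.
  by rewrite gtn_eqF ?mulr0 // (leq_trans (ltn_ord j)).
rewrite mulrA -exprD -[in (n + i)%N](subnK ni) -addnA addnn -mul2n exprD exprM.
by rewrite sqrrN !expr1n mulr1.
Qed.

(** Passing to det(X + L) removes the signs from the coefficients. *)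
Lemma lap_coef_opp (G : sgraph) j : (j <= #|G|)%N ->
  lap_coef G j = (char_poly (- laplacian G))`_(#|G| - j).
Proof. by move=> jG; rewrite [RHS]char_poly_oppmx_coef ?leq_subr // subKn. Qed.

Section ShiftedLaplacian.
Variable G : sgraph.
Implicit Types (f : G -> {poly int}) (u w : G).

(** The operator X + L, with L f u written as a sum of differences over the
    neighbours of u, so that only local values of f matter. *)
Definition shifted_lap f u : {poly int} :=
  'X * f u + \sum_(w : G | adj u w) (f u - f w).

Lemma mul_shifted_lap (n : nat) (f : 'I_n -> G -> {poly int}) :
  char_poly_mx (- laplacian G) *m (\matrix_(i, v) f v (enum_val i)) =
  \matrix_(i, v) shifted_lap (f v) (enum_val i).
Proof.
apply/matrixP => i v; rewrite !mxE /shifted_lap.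
under eq_bigr => j _ do rewrite !mxE rmorphN opprK rmorphB !rmorphMn /= mulrDl mulrBl.
rewrite big_split big_split /=; congr (_ + _).
  rewrite (bigD1 i) //= eqxx mulr1n big1 ?addr0 // => j ji.
  by rewrite eq_sym (negbTE ji) mul0r.
rewrite sumrB sumr_const; congr (_ + _).
  rewrite (bigD1 i) //= eqxx mulr1n big1 ?addr0 => [|j ji].
    rewrite mulr_natl /degree; congr (_ *+ _); apply: eq_card => w; by rewrite !inE.
  by rewrite eq_sym (negbTE ji) mul0r.
rewrite sumrN; congr (- _).
rewrite [RHS]big_mkcond.
transitivity (\sum_(w in G) if adj (enum_val i) w then f v w else 0); last first.
  exact: eq_bigl.
rewrite [RHS]big_enum_val; apply: eq_bigr => j _.
by case: adj; rewrite ?mul1r ?mul0r.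
Qed.

End ShiftedLaplacian.

(** Elimination from the leaves without division.  Let g be annihilated by
    X + L off the root.  Consider the matrix whose columns are the restrictions f v of g to the
    descendants of v; it is triangular for the depth, with diagonal g.
    Applied to f v, the operator X + L gives 0 at the strict descendants of v,
    where f v looks like g, and at the vertices unrelated to v and at least as
    deep, around which f v vanishes; at v itself it only misses the parent, so
    the value is g (par v).  Hence (X + L) applied to these columns is
    triangular the other way. *)
Lemma det_rooted_tree (G : sgraph) (root : G) (par : G -> G) (anc : rel G)
    (depth : G -> nat) (g : G -> {poly int}) :
  (forall u, anc root u) -> (forall v, anc v v) ->
  (forall u v, anc v u -> u != v -> (depth v < depth u)%N) ->
  (forall u v w, anc v u -> u != v -> adj u w -> anc v w) ->
  (forall u v w, ~~ anc v u -> adj u w -> anc v w -> (depth u < depth v)%N) ->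
  (forall v, v != root -> adj v (par v)) ->
  (forall v w, v != root -> adj v w -> anc v w = (w != par v)) ->
  (forall u, u != root -> shifted_lap g u = 0) ->
  \det (char_poly_mx (- laplacian G)) * \prod_u g u =
  shifted_lap g root * \prod_(u | u != root) g (par u).
Proof.
move=> anc_root anc_refl anc_lt anc_adj nanc_adj adj_par anc_par harm.
pose f (v w : G) := if anc v w then g w else 0.
have f_in u v : (forall w, adj u w -> anc v w) -> anc v u ->
    shifted_lap (f v) u = shifted_lap g u.
  move=> aw au; rewrite /shifted_lap /f au; congr (_ + _).
  by apply: eq_bigr => w /aw ->.
have f_root u : shifted_lap (f root) u = shifted_lap g u by apply: f_in.
have f_diag v : v != root -> shifted_lap (f v) v = g (par v).
  move=> vr; rewrite -[RHS]add0r -(harm v vr) /shifted_lap /f anc_refl -addrA.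
  congr (_ + _).
  rewrite (bigD1 (par v)) ?adj_par //= [in RHS](bigD1 (par v)) ?adj_par //=.
  rewrite anc_par ?adj_par // eqxx /= subr0 addrAC subrK; congr (_ + _).
  by apply: eq_bigr => w /andP[vw wp]; rewrite anc_par ?wp.
have f_off u v : u != v -> shifted_lap (f v) u != 0 -> (depth u < depth v)%N.
  move=> uv; have [au|nau] := boolP (anc v u).
    rewrite f_in // => [|w uw]; last exact: anc_adj uw.
    have [ur|ur] := eqVneq u root; last by rewrite harm ?eqxx.
    have := anc_lt v u; rewrite {1}ur anc_root eq_sym uv => /(_ isT isT) //.
  apply: contraR => dvu; rewrite /shifted_lap /f (negbTE nau) mulr0 add0r.
  apply/eqP; apply: big1 => w uw; case: ifP; rewrite ?subrr // => vw.
  by rewrite (nanc_adj u v w) in dvu.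
pose ev := fun i : 'I_#|G| => enum_val i : G.
have ev_inj : injective ev by exact: enum_val_inj.
have prod_ev (F : G -> {poly int}) : \prod_i F (ev i) = \prod_u F u.
  transitivity (\prod_(u in G) F u); last exact: eq_bigl.
  by rewrite [RHS]big_enum_val.
pose X : 'M[{poly int}]_#|G| := \matrix_(i, j) f (ev j) (ev i).
have detX : \det X = \prod_u g u.
  rewrite -det_tr (det_ranked (r := depth \o ev)).
    rewrite -(prod_ev g); apply: eq_bigr => i _.
    by rewrite !mxE /f anc_refl.
  move=> i j; rewrite !mxE /f; case: ifP; rewrite ?eqxx // => a _ ij.
  by apply: anc_lt => //; rewrite eq_sym (inj_eq ev_inj).
have MX : char_poly_mx (- laplacian G) *m X =
    \matrix_(i, j) shifted_lap (f (ev j)) (ev i) by exact: mul_shifted_lap.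
rewrite -detX -det_mulmx MX (det_ranked (r := depth \o ev)).
  rewrite [RHS](_ : _ = \prod_u shifted_lap (f u) u).
    by rewrite -prod_ev; apply: eq_bigr => i _; rewrite mxE.
  rewrite [RHS](bigD1 root) //= f_root; congr (_ * _).
  by apply: eq_bigr => u /f_diag.
move=> i j; rewrite !mxE => nz ij; apply: f_off => //.
by rewrite (inj_eq ev_inj).
Qed.

(** * The starlike tree *)

Section StarlikeDet.
Variables (k : nat) (p : 'I_k -> nat).
Hypothesis hp : forall i, (0 < p i)%N.

Notation vtx := (starlike p).
Notation arm_vertex m := (Some (Tagged (fun i => 'I_(p i)) m)).

Lemma arm_vertex_eqE i (m : 'I_(p i)) j (n : 'I_(p j)) :
  ((arm_vertex m : vtx) == arm_vertex n)
  = (i == j) && (m == n :> nat).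
Proof.
have [eij|nij] /= := eqVneq i j; last first.
  by apply/negbTE/eqP => /Some_inj/(congr1 tag)/eqP; rewrite (negbTE nij).
subst j; apply/eqP/eqP => [/Some_inj/eqP|/val_inj -> //].
by rewrite eq_Tagged => /eqP /= ->.
Qed.

Definition starlike_parent (u : vtx) : vtx :=
  if u is Some x then
    if tagged x == 0%N :> nat then None
    else arm_vertex (Ordinal (leq_ltn_trans (leq_pred _) (ltn_ord (tagged x))))
  else None.

Definition starlike_anc (v u : vtx) : bool :=
  match v, u with
  | None, _ => true
  | Some y, Some x => (tag x == tag y) && (tagged y <= tagged x)%N
  | _, _ => false
  end.

Definition starlike_depth (u : vtx) : nat :=
  if u is Some x then (tagged x).+1 else 0%N.

Lemma starlike_childE (w u : vtx) :
  starlike_child w u = (u != None) && (w == starlike_parent u).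
Proof.
case: u => [[i m]|]; case: w => [[j n]|] //=; case: (m == 0 :> nat) /eqP => [m0|m0] //=.
- by rewrite m0 andbF.
- rewrite arm_vertex_eqE /=; case: (j == i) => //=; lia.
Qed.

Definition arm_rest i := \prod_(l | l != i) arm_poly (p l).

(** Up to the factor [arm_rest], the value on an arm is the arm polynomial of the
    part strictly beyond the vertex; it extends to the root as the full product,
    and the factors make the arms agree there. *)
Definition starlike_pot (u : vtx) : {poly int} :=
  if u is Some x then arm_rest (tag x) * arm_poly (p (tag x) - (tagged x).+1)
  else \prod_l arm_poly (p l).

Lemma starlike_pot_parent x :
  starlike_pot (starlike_parent (Some x)) =
  arm_rest (tag x) * arm_poly (p (tag x) - tagged x).
Proof.
case: x => i m /=; case: (m == 0 :> nat) /eqP => [m0|m0] /=.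
  by rewrite m0 subn0 (bigD1 i) //= mulrC.
by rewrite prednK // lt0n; apply/eqP.
Qed.

(** With m vertices beyond the current one, this is the recurrence
    b_(m+1) - (X + 2) b_m + b_(m-1) = 0.  At the end of an arm the missing
    neighbour is replaced by the convention b_(-1) = b_0, which truncated
    subtraction provides. *)
Lemma shifted_pot_arm x : shifted_lap starlike_pot (Some x) = 0.
Proof.
rewrite /shifted_lap (bigD1 (starlike_parent (Some x))) /=; last first.
  by rewrite /starlike_adj /= [starlike_child _ (Some x)]starlike_childE eqxx orbT.
set S := \sum_(w | _) _.
have -> : S = starlike_pot (Some x)
     - arm_rest (tag x) * arm_poly (p (tag x) - (tagged x).+2).
  case: x @S => i m /=.
  have [ltm|gem] := ltnP m.+1 (p i).
    pose c : vtx := arm_vertex (Ordinal ltm).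
    rewrite (big_pred1 c) // => w.
    rewrite /starlike_adj /=.
    case: w => [[j n]|] /=.
      rewrite arm_vertex_eqE /=; case: (m == 0 :> nat) /eqP => [m0|m0] /=.
        rewrite andbT [i == j]eq_sym; case: (j == i) => //=; lia.
      rewrite !arm_vertex_eqE /= [i == j]eq_sym; case: (j == i) => /=; lia.
    by case: ifP.
  rewrite big1 => [|w /andP[]].
    have -> : (p i - m.+1 = p i - m.+2)%N by lia.
    by rewrite subrr.
  rewrite /starlike_adj /= [starlike_child w _]starlike_childE /=.
  case/orP => [+ _|wp /negP[]]; last exact: wp.
  case: w => // -[j n] /=.
  case: (i =P j) => //= eij; subst j; have := ltn_ord n; lia.
rewrite starlike_pot_parent {S}; case: x => i m /=.
have : (m < p i)%N by [].
rewrite !subnS; have : (0 < p i - m)%N by rewrite subn_gt0.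
case: (p i - m)%N => // -[|n] _ _ /=; rewrite !(arm_polyS, arm_incrS, arm_poly0, arm_incr0); ring.
Qed.

Lemma shifted_pot_root : shifted_lap starlike_pot None = starlike_poly p.
Proof.
rewrite /shifted_lap /starlike_poly mulrDr mulr_sumr; congr (_ + _).
pose h (i : 'I_k) : vtx := arm_vertex (Ordinal (hp i)).
pose h' (u : vtx) : option 'I_k := omap tag u.
rewrite (reindex_omap h h') /=; last first.
  case=> [[j n]|] //=; rewrite /in_mem /= /starlike_adj /= orbF => n0.
  by congr Some; apply/eqP; rewrite /h arm_vertex_eqE /= eqxx eq_sym.
apply: eq_big => [i|i _]; first by rewrite /starlike_adj /= eqxx.
rewrite /starlike_pot /= (bigD1 i) //= -/(arm_rest i).
have [n ->] : exists n, p i = n.+1 by exists (p i).-1; rewrite prednK.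
by rewrite subn1 arm_polyS; ring.
Qed.

(** Along each arm the left-hand product is shifted by one vertex towards the
    root: it loses the value b_0 = 1 at the leaf and gains b_(p i), and these
    gains multiply to the value at the root. *)
Lemma prod_pot_parent :
  \prod_(u : vtx | u != None) starlike_pot (starlike_parent u) =
  \prod_(u : vtx) starlike_pot u.
Proof.
have some_prod (F : vtx -> {poly int}) :
    \prod_(u : vtx | u != None) F u =
    \prod_i \prod_(m < p i) F (arm_vertex m).
  rewrite (reindex_omap Some id) /=; last by case.
  rewrite sig_big_dep /=; apply: eq_big => [x|[i m] //].
  by rewrite eqxx.
rewrite [RHS](bigD1 None) //= some_prod [X in _ * X]some_prod /= -big_split; apply: eq_bigr => i _ /=.
under eq_bigr => m _ do rewrite -/(starlike_parent (arm_vertex m)) starlike_pot_parent /=.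
rewrite !big_split /= mulrCA; congr (_ * _).
(* One product over p i + 1 indices, with either its last or its first factor
   split off. *)
have := erefl (\prod_(m < (p i).+1) arm_poly (p i - m)).
rewrite {1}big_ord_recr big_ord_recl /= subnn mulr1 subn0 => ->.
by congr (_ * _).
Qed.

Lemma char_poly_starlike : char_poly (- laplacian vtx) = starlike_poly p.
Proof.
have pot_neq0 : \prod_(u : vtx) starlike_pot u != 0.
  apply/prodf_neq0 => u _.
  have prod_b (P : pred 'I_k) : \prod_(l | P l) arm_poly (p l) != 0.
    by apply/prodf_neq0 => l _; apply: arm_poly_neq0.
  by case: u => [x|]; [apply: mulf_neq0 (prod_b _) (arm_poly_neq0 _) | apply: prod_b].
apply: (mulIf pot_neq0).
rewrite /char_poly (det_rooted_tree (root := None : vtx) (par := starlike_parent)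
  (anc := starlike_anc) (depth := starlike_depth)).
- by rewrite shifted_pot_root prod_pot_parent.
- by [].
- by case=> [x|] //=; rewrite eqxx leqnn.
- case=> [[i m]|] [[j n]|] //=.
  move=> /andP[ij nm]; rewrite arm_vertex_eqE ij /= ltnS; lia.
- move=> u [[j n]|] w //; case: u => [[i m]|] //= /andP[/eqP ij nm].
  subst j; rewrite arm_vertex_eqE eqxx /= => nem; rewrite /starlike_adj /=.
  case: w => [[l r]|] /=; last by lia.
  by rewrite eq_sym; case: (l == i) => //=; lia.
- move=> [[i m]|] [[j n]|] [[l r]|] //=.
  rewrite /starlike_adj /= => + + /andP[/eqP lj nr]; subst l.
  by rewrite [j == i]eq_sym; case: (i == j) => //=; lia.
- move=> [x|] // _; change (starlike_adj (Some x) (starlike_parent (Some x))).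
  by rewrite /starlike_adj /= [starlike_child _ (Some x)]starlike_childE eqxx orbT.
- move=> [[i m]|] // w _; change (starlike_adj (arm_vertex m) w ->
     starlike_anc (arm_vertex m) w = (w != starlike_parent (arm_vertex m))).
  rewrite /starlike_adj /= -[w == _]andTb -[true](_ : arm_vertex m != None :> vtx) // -starlike_childE.
  case: w => [[j n]|] /=; last by move=> ->.
  by rewrite eq_sym; case: (j == i) => //=; lia.
- by case=> [x|] // _; apply: shifted_pot_arm.
Qed.

End StarlikeDet.

Theorem theorem8 (k : nat) (hk : (2 <= k)%N) (p q : 'I_k -> nat)
    (hp : forall i : 'I_k, (0 < p i)%N)
    (hq : forall i : 'I_k, (0 < q i)%N)
    (hpq : majorized (fun i : 'I_k => (p i)%:Z) (fun i : 'I_k => (q i)%:Z)) :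
  lap_coef_le (starlike p) (starlike q).
Proof.
have [[sp sq] pre tot] := hpq.
have psumZ (r : 'I_k -> nat) m : (psum r m)%:Z = \sum_(i < k | (i < m)%N) (r i)%:Z.
  by rewrite /psum -[LHS]natz natr_sum; apply: eq_bigr => i _; rewrite natz.
have totE : psum p k = psum q k.
  apply/eqP; rewrite -eqz_nat !psumZ; apply/eqP.
  by under eq_bigl do rewrite ltn_ord; under [RHS]eq_bigl do rewrite ltn_ord.
have psum_ge (r : 'I_k -> nat) m : (k <= m)%N -> psum r m = psum r k.
  by move=> km; apply: eq_bigl => i; rewrite ltn_ord (leq_trans (ltn_ord i)).
have le_pq : nneg_coef (starlike_poly q - starlike_poly p).
  apply: (@majorization_ind k (fun p q => nneg_coef (starlike_poly q - starlike_poly p))).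
  - by move=> p' q' e; rewrite (eq_starlike_poly e) subrr; apply: nneg_coef0.
  - move=> p' q' a c ac pca pc0 IH.
    rewrite -(subrKA (starlike_poly (transfer p' a c))); apply: nneg_coefD IH _.
    exact: starlike_poly_transfer.
  - by move=> i j /sp; rewrite lez_nat.
  - by move=> i j /sq; rewrite lez_nat.
  - move=> m; have [km|mk] := leqP k m; first by rewrite !psum_ge ?totE.
    case: m mk => [|m] mk; first by rewrite /psum !big_pred0.
    by rewrite -lez_nat !psumZ; apply: pre.
  - exact: totE.
have cardE : #|starlike p| = #|starlike q|.
  rewrite !card_starlike; congr (_ + _)%N; move: totE; rewrite /psum.
  by under eq_bigl do rewrite ltn_ord; under [RHS]eq_bigl do rewrite ltn_ord.
split=> // j jn; rewrite !lap_coef_opp -?cardE // !char_poly_starlike //.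
by have := le_pq (#|starlike p| - j)%N; rewrite coefB subr_ge0 -cardE.
Qed.
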